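(* Let $B$ be a closed nondensely defined Hermitian contraction in $\mathfrak H$ with associated $\mathfrak H_0,\mathfrak N,B_0,K_0$, let $\mathcal H$ be a Hilbert space, and let $$X=\begin{bmatrix}X_{11}&X_{12}\\ X_{12}^*&X_{22}\end{bmatrix}$$ be a selfadjoint contraction in $\mathfrak D_{K_0^*}\oplus\mathcal H$. Let $$\widetilde B_X=\begin{bmatrix}B_0&D_{B_0}K_0^*&0\\ K_0D_{B_0}&-K_0B_0K_0^*+D_{K_0^*}X_{11}D_{K_0^*}&D_{K_0^*}X_{12}\\ 0&X_{12}^*D_{K_0^*}&X_{22}\end{bmatrix}\quad\text{in }\mathfrak H_0\oplus\mathfrak N\oplus\mathcal H=\mathfrak H\oplus\mathcal H .$$ Then $$(I\pm\widetilde B_X)_{\mathcal H}\upharpoonright\mathcal H=(I\pm X)_{\mathcal H}\upharpoonright\mathcal H .$$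
   Context: All Hilbert spaces are complex and separable. For a contraction $T:H_1\to H_2$, $D_T=(I-T^*T)^{1/2}$ and $\mathfrak D_T$ is the closure of $\operatorname{ran}D_T$. A closed nondensely defined Hermitian contraction $B$ in $\mathfrak H$ is a linear operator defined on a proper closed subspace $\mathfrak H_0=\operatorname{dom}B$ of $\mathfrak H$, with $\|Bf\|\le\|f\|$ and $(Bf,g)=(f,Bg)$ for $f,g\in\mathfrak H_0$. Put $\mathfrak N=\mathfrak H\ominus\mathfrak H_0$, $B_0=P_{\mathfrak H_0}B$ (a selfadjoint contraction in $\mathfrak H_0$), and let $K_0:\mathfrak D_{B_0}\to\mathfrak N$ be the contraction determined by $K_0D_{B_0}f=P_{\mathfrak N}Bf$, $f\in\mathfrak H_0$. Thus $K_0^*:\mathfrak N\to\mathfrak D_{B_0}\subseteq\mathfrak H_0$, $D_{K_0^*}$ acts in $\mathfrak N$, and $\mathfrak D_{K_0^*}\subseteq\mathfrak N$. The operator $\widetilde B_X$ is a selfadjoint contractive extension of $B$ in $\mathfrak H\oplus\mathcal H$. For a bounded nonnegative operator $S$ in a Hilbert space $L$ and a closed subspace $K\subseteq L$, the shorted operator is $S_K=\max\{Z\in\mathbf L(L):0\le Z\le S,\ \operatorname{ran}Z\subseteq K\}$; equivalently $(S_Kf,f)=\inf_{\varphi\in L\ominus K}(S(f+\varphi),f+\varphi)$, $f\in L$. Here $\mathcal H$ is regarded as a subspace of $\mathfrak H\oplus\mathcal H$ on the left-hand side and of $\mathfrak D_{K_0^*}\oplus\mathcal H$ on the right-hand side.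 *)

(* Defs.v *)
From HB Require Import structures.
From mathcomp Require Import all_boot all_order all_algebra.
From mathcomp Require Import all_classical all_reals topology normedtype.
From mathcomp Require Import complex.

Set Implicit Arguments.
Unset Strict Implicit.
Unset Printing Implicit Defensive.

Import Order.TTheory GRing.Theory Num.Theory.
Import numFieldNormedType.Exports.

Local Open Scope classical_set_scope.
Local Open Scope ring_scope.

(* The inner product is linear in its first argument and conjugate-linear in
   the second one. *)
HB.mixin Record isInnerProduct (R : realType) V of GRing.Lmodule R[i] V := {
  inner : {dot V for (@Num.conj R[i])}
}.

#[short(type="innerProductType")]
HB.structure Definition InnerProduct (R : realType) :=
  {V of isInnerProduct R V & GRing.Lmodule R[i] V}.

(* Complex separable Hilbert spaces; the norm of an [R[i]]-normed module takes
   its (real) values in [R[i]]. *)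
HB.mixin Record InnerProduct_isHilbert (R : realType) H
    of InnerProduct R H & CompleteNormedModule R[i] H := {
  normr_inner : forall x : H, `|x| ^+ 2 = inner x x;
  hilbert_separable : exists D : set H, countable D /\ dense D
}.

#[short(type="hilbertType")]
HB.structure Definition Hilbert (R : realType) :=
  {H of InnerProduct R H & CompleteNormedModule R[i] H
      & InnerProduct_isHilbert R H}.

(* Orthogonal sum of two inner product spaces, carried by the product. *)
Section OrthogonalSum.
Context {R : realType} {V1 V2 : innerProductType R}.

Definition sum_inner (u v : V1 * V2) : R[i] :=
  inner u.1 v.1 + inner u.2 v.2.

Let sum_inner_linearl v :
  GRing.linear_for (@GRing.mul R[i]) (sum_inner^~ v).
Proof.
by move=> a x y; rewrite /sum_inner /= !linearPl /= !mulrDr addrACA.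
Qed.

Let sum_inner_linearr u :
  GRing.linear_for (Num.conj \; *%R) (sum_inner u).
Proof.
by move=> a x y; rewrite /sum_inner /= !linearPr /= !mulrDr addrACA.
Qed.

HB.instance Definition _ := @bilinear_isBilinear.Build R[i]
  (V1 * V2)%type (V1 * V2)%type R[i] *%R (Num.conj \; *%R) sum_inner
  (sum_inner_linearl, sum_inner_linearr).

Let sum_inner_hermitian u v :
  sum_inner u v = (-1) ^+ false * Num.conj (sum_inner v u).
Proof.
by rewrite /sum_inner rmorphD mulrDr; congr (_ + _);
  exact: hermitian_subproof.
Qed.

HB.instance Definition _ := @isHermitianSesquilinear.Build R[i]
  (V1 * V2)%type false (@Num.conj R[i]) sum_inner sum_inner_hermitian.

Let inner_ge0 (V : innerProductType R) (x : V) : 0 <= inner x x.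
Proof.
have [->|x0] := eqVneq x 0; first by rewrite linear0l.
exact/ltW/neq0_dnorm_gt0.
Qed.

Let sum_inner_gt0 u : u != 0 -> 0 < sum_inner u u.
Proof.
case: u => x y; rewrite /sum_inner /= -pair_eqE /= negb_and => /orP[x0|y0].
  by rewrite ltr_wpDr ?inner_ge0// neq0_dnorm_gt0.
by rewrite ltr_wpDl ?inner_ge0// neq0_dnorm_gt0.
Qed.

HB.instance Definition _ := @isDotProduct.Build R[i]
  (V1 * V2)%type sum_inner sum_inner_gt0.

HB.instance Definition _ := @isInnerProduct.Build R (V1 * V2)%type
  (sum_inner : {dot (V1 * V2)%type for (@Num.conj R[i])}).

End OrthogonalSum.

Definition orthocomp {R : realType} {V : innerProductType R} (K : set V) :
    set V :=
  [set y | forall x, K x -> inner x y = 0].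

(* Orthogonal projection onto K (meaningful when K is a closed subspace of a
   Hilbert space, where such a point exists and is unique). *)
Definition orthoproj {R : realType} {V : innerProductType R} (K : set V) (x : V) :
    V :=
  xget 0 [set y | K y /\ orthocomp K (x - y)].

Definition closed_subspace {R : realType} {H : hilbertType R} (K : set H) :
    Prop :=
  [/\ closed K, K 0 &
      forall (a : R[i]) x y, K x -> K y -> K (a *: x + y)].

(* An operator between subspaces K of U and L of V is represented by a function
   U -> V of which only the values on K are relevant; all the notions below only
   depend on these values. *)
Section Operators.
Context {R : realType}.
Implicit Types U V : innerProductType R.

(* Bounded linear operators defined on K, with values in L. *)
Definition operator {U V} (K : set U) (L : set V) (T : U -> V) : Prop :=
  [/\ forall (a : R[i]) x y, K x -> K y -> T (a *: x + y) = a *: T x + T y,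
      forall x, K x -> L (T x) &
      exists M : R[i], forall x, K x -> inner (T x) (T x) <= M * inner x x].

Definition contractive_op {U V} (K : set U) (L : set V) (T : U -> V) : Prop :=
  operator K L T /\ forall x, K x -> inner (T x) (T x) <= inner x x.

Definition hermitian_on {U} (K : set U) (T : U -> U) : Prop :=
  forall x y, K x -> K y -> inner (T x) y = inner x (T y).

Definition selfadjoint_contraction {U} (K : set U) (T : U -> U) : Prop :=
  contractive_op K K T /\ hermitian_on K T.

Definition is_adjoint {U V} (K : set U) (L : set V) (T : U -> V) (A : V -> U) :
    Prop :=
  operator L K A /\ forall x y, K x -> L y -> inner (T x) y = inner x (A y).

(* The order of R[i] makes [a <= b] contain the equality of imaginary parts. *)
Definition op_le {U} (K : set U) (S T : U -> U) : Prop :=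
  forall x, K x -> inner (S x) x <= inner (T x) x.

Definition nonneg_operator {U} (K : set U) (T : U -> U) : Prop :=
  operator K K T /\ op_le K (fun=> 0) T.

Definition is_sqrt {U} (K : set U) (S D : U -> U) : Prop :=
  nonneg_operator K D /\ forall x, K x -> D (D x) = S x.

(* D is the defect operator (I - T^* T)^{1/2}, in K, of T : K -> L. *)
Definition is_defect {U V} (K : set U) (L : set V) (T : U -> V) (D : U -> U) :
    Prop :=
  exists2 A, is_adjoint K L T A & is_sqrt K (fun x => x - A (T x)) D.

(* The shorted operator of S (in the space L) to the subspace K: the largest Z
   in L with 0 <= Z <= S and ran Z included in K. For S >= 0 and closed subspaces
   K of L, it exists and is unique on L; [xget] selects a representative. *)
Definition shorted_candidate {U} (L K : set U) (S Z : U -> U) : Prop :=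
  [/\ nonneg_operator L Z, op_le L Z S & forall x, L x -> K (Z x)].

Definition is_shorted {U} (L K : set U) (S Z : U -> U) : Prop :=
  shorted_candidate L K S Z /\
  forall Z', shorted_candidate L K S Z' -> op_le L Z' Z.

Definition shorted {U} (L K : set U) (S : U -> U) : U -> U :=
  xget (fun=> 0) [set Z | is_shorted L K S Z].

End Operators.

Definition defect_space {R : realType} {H : hilbertType R} (K : set H)
    (D : H -> H) : set H :=
  closure (D @` K).

Definition nondense_hermitian_contraction {R : realType} {H : hilbertType R}
    (H0 : set H) (B : H -> H) : Prop :=
  [/\ closed_subspace H0, H0 <> setT, contractive_op H0 setT B &
      hermitian_on H0 B].

(* B_0 = P_{H_0} B *)
Definition compression {R : realType} {H : hilbertType R} (H0 : set H)
    (B : H -> H) : H -> H :=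
  orthoproj H0 \o B.

Section Blocks.
Context {R : realType} {H G : hilbertType R}.

Definition block_op (X11 : H -> H) (X12 : G -> H) (X21 : H -> G)
    (X22 : G -> G) : H * G -> H * G :=
  fun z => (X11 z.1 + X12 z.2, X21 z.1 + X22 z.2).

(* The 3x3 block operator in H_0 (+) N (+) G = H (+) G, N the orthogonal
   complement of H_0: the H-component of the value is the sum of its components
   in H_0 and in N. The arguments D, K0s, Dk stand for D_{B_0}, K_0^*,
   D_{K_0^*}. *)
Definition tildeB (H0 : set H) (B0 D K0 K0s Dk : H -> H) (X11 : H -> H)
    (X12 : G -> H) (X21 : H -> G) (X22 : G -> G) : H * G -> H * G :=
  fun z =>
    let f := orthoproj H0 z.1 in
    let n := orthoproj (orthocomp H0) z.1 in
    let h := z.2 in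
    ((B0 f + D (K0s n)) +
     (K0 (D f) + (- K0 (B0 (K0s n)) + Dk (X11 (Dk n))) + Dk (X12 h)),
     X21 (Dk n) + X22 h).

(* G as a subspace of H (+) G *)
Definition second_summand : set (H * G) := [set z | z.1 = 0].

End Blocks.

(* Main.v *)
(** Completing squares, the quadratic form of [I ± BX] at [(f + n, h)], with
    [f] in [H0] and [n] in [N], splits as the form of [I ± X] at [(Dk n, h)]
    plus the form of the block matrix [1 ± B0, ± D; ± D, 1 ∓ B0] at
    [(f, K0s n)]. This matrix is half of its own square, because [D] commutes
    with [B0], so the second term is nonnegative; its infimum over [f] is [0]
    because [K0s n] lies in the closure of the range of [D]. Hence the same
    operators on [G] minorize both forms, and the largest one is the same. *)

Require Import Defs.
From mathcomp Require Import all_boot all_order all_algebra.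
From mathcomp Require Import all_classical all_reals topology normedtype.
From mathcomp Require Import complex ring lra.

Set Implicit Arguments.
Unset Strict Implicit.
Unset Printing Implicit Defensive.

Import Order.TTheory GRing.Theory Num.Theory.
Import numFieldNormedType.Exports.

Local Open Scope classical_set_scope.
Local Open Scope ring_scope.

(** The commutation of [D] with [B0] is not among the data: [D] is only known to be a nonnegative
    square root of [1 - B0^2]. It is derived without functional calculus. The commutator
    anticommutes with [D], hence intertwines [1 + D] with [1 - D]; powers of the latter are bounded,
    while powers of the former grow on every vector that [D] does not kill. The block matrix is
    [1 ± J] with [J = [B0, D; D, -B0]], and commutation is exactly what makes [J^2 = 1]. The kernel
    of [1 + J] contains the vectors [(- (g - B0 g), D g)], which provides explicit near-minimizers
    [f]. Two closures intervene: [K0s n] is only a limit of values of [D], and a vector of the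
    defect space of [K0s] only a limit of values of [Dk]. The forms are therefore compared up to
    errors, and one parameter [t] serves both as the size of these errors and as the weight in
    Young's inequality. The lower sign comes from replacing [B0], [D], [X] by their opposites, so
    positivity of [D] may be used for the commutation but nowhere after it. *)

Section RealInner.
Context {R : realType} {V : innerProductType R}.
Implicit Types (x y z : V) (a : R).

(** Estimates are made in the ordered field [R], the order of [R[i]] being only partial; on the
    diagonal nothing is lost, by [innerxx]. *)
Definition rinner x y : R := complex.Re (inner x y).

Lemma innerC x y : inner x y = Num.conj (inner y x).
Proof. by rewrite hermC expr0 mul1r. Qed.

Lemma inner_ge0 x : 0 <= inner x x.
Proof.
have [->|x0] := eqVneq x 0; first by rewrite linear0l.
exact/ltW/neq0_dnorm_gt0.
Qed.

Lemma innerxx x : inner x x = (rinner x x)%:C%C.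
Proof.
have := inner_ge0 x; rewrite /rinner; case: (inner x x) => b c.
by rewrite lecE/= => /andP[/eqP ->].
Qed.

Lemma rinner_ge0 x : 0 <= rinner x x.
Proof. by have := inner_ge0 x; rewrite innerxx ler0c. Qed.

Lemma rinner_eq0 x : rinner x x = 0 -> x = 0.
Proof.
move=> x0; apply/eqP/negPn/negP => /(@neq0_dnorm_gt0 _ _ _ inner).
by rewrite innerxx x0 ltxx.
Qed.

Lemma rinnerC x y : rinner x y = rinner y x.
Proof. by rewrite /rinner innerC; case: (inner y x). Qed.

Lemma rinnerDl x y z : rinner (x + y) z = rinner x z + rinner y z.
Proof. by rewrite /rinner linearDl/=; case: (inner x z); case: (inner y z). Qed.

Lemma rinnerDr x y z : rinner x (y + z) = rinner x y + rinner x z.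
Proof. by rewrite rinnerC rinnerDl !(rinnerC x). Qed.

Lemma rinnerNl x y : rinner (- x) y = - rinner x y.
Proof. by rewrite /rinner linearNl/=; case: (inner x y). Qed.

Lemma rinnerNr x y : rinner x (- y) = - rinner x y.
Proof. by rewrite rinnerC rinnerNl rinnerC. Qed.

Lemma rinnerZl a x y : rinner (a%:C%C *: x) y = a * rinner x y.
Proof.
by rewrite /rinner linearZl_LR/=; case: (inner x y) => b c/=; ring.
Qed.

Lemma rinnerZr a x y : rinner x (a%:C%C *: y) = a * rinner x y.
Proof. by rewrite rinnerC rinnerZl rinnerC. Qed.

Lemma rinner0l x : rinner 0 x = 0.
Proof. by rewrite -(subrr x) rinnerDl rinnerNl subrr. Qed.

Definition rinnerE :=
  (rinnerDl, rinnerDr, rinnerNl, rinnerNr, rinnerZl, rinnerZr).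

Lemma rinner_sqrB x y : 2 * rinner x y <= rinner x x + rinner y y.
Proof.
have := rinner_ge0 (x - y); rewrite !rinnerE (rinnerC y x); lra.
Qed.

End RealInner.

(** * Linear operators and quadratic forms on subspaces *)

Section Subspaces.
Context {R : realType}.
Implicit Types U V : innerProductType R.

(** The algebraic part of [closed_subspace], stated for inner product spaces because it is also
    applied in [H * G], which is used only as such. *)
Definition linear_subspace {U} (K : set U) :=
  K 0 /\ forall (a : R[i]) x y, K x -> K y -> K (a *: x + y).

Definition linear_on {U V} (K : set U) (T : U -> V) :=
  forall (a : R[i]) x y, K x -> K y -> T (a *: x + y) = a *: T x + T y.

Section Subspace.
Context {U : innerProductType R} {K : set U} (sK : linear_subspace K).

Lemma subspace0 : K 0. Proof. by case: sK. Qed.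

Lemma subspaceD x y : K x -> K y -> K (x + y).
Proof. by move=> ? ?; rewrite -(scale1r x); apply: sK.2. Qed.

Lemma subspaceZ a x : K x -> K (a *: x).
Proof. by move=> ?; rewrite -[_ *: _]addr0; apply: sK.2 => //; case: sK. Qed.

Lemma subspaceN x : K x -> K (- x).
Proof. by rewrite -scaleN1r; apply: subspaceZ. Qed.

Lemma subspaceB x y : K x -> K y -> K (x - y).
Proof. by move=> ? ?; apply/subspaceD/subspaceN. Qed.

Context {V : innerProductType R} {T : U -> V} (lT : linear_on K T).

Lemma linear_onD x y : K x -> K y -> T (x + y) = T x + T y.
Proof. by move=> Kx Ky; have := lT 1 Kx Ky; rewrite !scale1r. Qed.

Lemma linear_on0 : T 0 = 0.
Proof.
by apply: (addIr (T 0)); rewrite -linear_onD ?addr0 ?add0r//; case: sK.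
Qed.

Lemma linear_onZ a x : K x -> T (a *: x) = a *: T x.
Proof.
by move=> Kx; have := lT a Kx subspace0; rewrite linear_on0 !addr0.
Qed.

Lemma linear_onN x : K x -> T (- x) = - T x.
Proof. by move=> Kx; rewrite -scaleN1r linear_onZ// scaleN1r. Qed.

Lemma linear_onB x y : K x -> K y -> T (x - y) = T x - T y.
Proof. by move=> Kx Ky; rewrite linear_onD ?linear_onN//; apply: subspaceN. Qed.

End Subspace.

Lemma inner_ext {U} (K : set U) x y : linear_subspace K -> K x -> K y ->
  (forall z, K z -> inner x z = inner y z) -> x = y.
Proof.
move=> sK Kx Ky xy; apply/eqP; rewrite -subr_eq0; apply/eqP/rinner_eq0.
by rewrite /rinner linearBl/= xy ?subrr//; apply: subspaceB.
Qed.

Lemma hermitian_rinner {U} (K : set U) T x y : hermitian_on K T ->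
  K x -> K y -> rinner (T x) y = rinner x (T y).
Proof. by move=> hT Kx Ky; rewrite /rinner hT. Qed.

(* Polarization: over the complex numbers a real quadratic form is hermitian. *)
Lemma real_form_hermitian {U} (K : set U) T : linear_subspace K -> linear_on K T ->
  (forall x, K x -> complex.Im (inner (T x) x) = 0) -> hermitian_on K T.
Proof.
move=> sK lT real x y Kx Ky.
have e1 := real _ (subspaceD sK Kx Ky).
have Kix : K ('i%C *: x) by apply: subspaceZ.
have e2 := real _ (subspaceD sK Kix Ky).
have ex := real _ Kx; have ey := real _ Ky; have eix := real _ Kix.
move: e1 e2 eix; rewrite !(linear_onD lT)// !(linear_onZ sK lT)//.
rewrite !linearDl/= !linearDr/= !linearZl_LR/= !linearZr_LR/=.
rewrite (innerC x (T y)).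
move: ex ey; case: (inner (T x) x) => a b; case: (inner (T y) y) => c d.
case: (inner (T x) y) => e f; case: (inner (T y) x) => g h/= -> ->.
move=> e1 e2 _; apply/eqP; rewrite eq_complex/=; apply/andP; split; apply/eqP; lra.
Qed.

Lemma nonneg_hermitian {U} (K : set U) T : linear_subspace K ->
  nonneg_operator K T -> hermitian_on K T.
Proof.
move=> sK [[lT _ _] T0]; apply: real_form_hermitian => // x Kx.
by have := T0 x Kx; rewrite linear0l => /ger0_Im.
Qed.

Lemma nonneg_rinner {U} (K : set U) T x :
  nonneg_operator K T -> K x -> 0 <= rinner (T x) x.
Proof.
move=> [_ T0] Kx; have := T0 _ Kx; rewrite linear0l lecE => /andP[_].
by rewrite /rinner.
Qed.

(** A null form is real, so [T] is hermitian, and the form at [x + T x] reduces to [2 ‖T x‖^2]. This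
    makes [op_le] antisymmetric. *)
Lemma null_form_eq0 {U} (K : set U) T : linear_subspace K -> linear_on K T ->
  (forall x, K x -> K (T x)) -> (forall x, K x -> inner (T x) x = 0) ->
  forall x, K x -> T x = 0.
Proof.
move=> sK lT KT T0 x Kx.
have hT : hermitian_on K T.
  by apply: real_form_hermitian => // y /T0 ->.
have KTx := KT _ Kx.
have := T0 _ (subspaceD sK Kx KTx).
rewrite (linear_onD lT)// !linearDl/= !linearDr/= !T0// add0r addr0.
rewrite (hT _ _ KTx Kx) => /(congr1 (@complex.Re R)) xTTx.
by apply: rinner_eq0; move: xTTx; rewrite /rinner; case: (inner _ _) => a b/=; lra.
Qed.

End Subspaces.

(** * A hermitian contraction commutes with its defect operator *)

Section Defect.
Context {R : realType} {U : innerProductType R}.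
Variables (K : set U) (b d : U -> U).
Hypotheses (sK : linear_subspace K) (lb : linear_on K b) (ld : linear_on K d).
Hypotheses (Kb : forall x, K x -> K (b x)) (Kd : forall x, K x -> K (d x)).
Hypotheses (hb : hermitian_on K b) (hd : hermitian_on K d).
Hypothesis dd : forall x, K x -> d (d x) = x - b (b x).

Let dotb x y : K x -> K y -> rinner (b x) y = rinner x (b y).
Proof. exact: hermitian_rinner. Qed.

Let dotd x y : K x -> K y -> rinner (d x) y = rinner x (d y).
Proof. exact: hermitian_rinner. Qed.

Lemma defect_norm x : K x ->
  rinner (d x) (d x) = rinner x x - rinner (b x) (b x).
Proof.
by move=> Kx; rewrite -[LHS]dotd ?dd ?rinnerE ?dotb//; auto.
Qed.

Hypothesis d0 : forall x, K x -> 0 <= rinner (d x) x.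

Let c x := d (b x) - b (d x).

Let Kc x : K x -> K (c x).
Proof. by move=> Kx; apply: subspaceB => //; auto. Qed.

(** Both sides equal [b d^2 - d b d], since [d^2 = 1 - b^2] commutes with [b]. *)
Let dc x : K x -> d (c x) = - c (d x).
Proof.
move=> Kx; rewrite /c (linear_onB sK ld) ?dd//; auto.
rewrite (linear_onB sK lb)//; auto.
by rewrite opprB.
Qed.

Let grow y := y + d y.
Let shrink x := x - d x.

Let Kgrow k y : K y -> K (iter k grow y).
Proof. by move=> Ky; elim: k => //= k IH; apply: subspaceD => //; auto. Qed.

Let Kshrink k y : K y -> K (iter k shrink y).
Proof. by move=> Ky; elim: k => //= k IH; apply: subspaceB => //; auto. Qed.

Let grow_c k x : K x -> iter k grow (c x) = c (iter k shrink x).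
Proof.
move=> Kx; elim: k => //= k ->; have := Kshrink k Kx.
move: (iter k shrink x) => z Kz; rewrite /grow /shrink dc//.
rewrite /c (linear_onB sK lb)// ?(linear_onB sK ld)//; auto.
by rewrite (linear_onB sK lb)//; auto; rewrite !opprD !opprK addrACA.
Qed.

(** Amounts to [d^2 <= 2 d]. Positivity of [d] at [x - d x], with [(d (d x), d x) <= ‖d x‖^2], even
    gives [d^2 <= d]. *)
Let shrink_norm x : K x -> rinner (shrink x) (shrink x) <= rinner x x.
Proof.
move=> Kx; have Kdx := Kd Kx; have Kddx := Kd Kdx.
have e := d0 (subspaceB sK Kx Kdx).
have := defect_norm Kdx; have := rinner_ge0 (b (d x)).
have := rinner_sqrB (d (d x)) (d x).
move: e; rewrite /shrink (linear_onB sK ld)// !rinnerE (dotd Kdx Kx).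
rewrite (rinnerC x (d x)); have := rinner_ge0 (d x); lra.
Qed.

(** Parallelogram law: [d (b x)] and [b (d x)] are both no longer than [x]. *)
Let c_norm x : K x -> rinner (c x) (c x) <= 4 * rinner x x.
Proof.
move=> Kx; have Kdx := Kd Kx; have Kbx := Kb Kx.
have := rinner_ge0 (d (b x) + b (d x)).
rewrite /c !rinnerE (rinnerC (b (d x)) (d (b x))).
have := defect_norm Kx; have := defect_norm Kdx; have := defect_norm Kbx.
have := rinner_ge0 (d (d x)); have := rinner_ge0 (b (b x)).
have := rinner_ge0 (d x); have := rinner_ge0 (b x).
lra.
Qed.

(** As [d >= 0], passing from [z] to [z + d z] adds at least [‖d z‖^2] to the squared norm; the
    second conjunct, needed by the induction, keeps [‖d z‖] from dropping below [‖d y‖]. *)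
Let grow_norm k y : K y ->
  k%:R * rinner (d y) (d y) <= rinner (iter k grow y) (iter k grow y) /\
  rinner (d y) (d y) <= rinner (d (iter k grow y)) (d (iter k grow y)).
Proof.
move=> Ky; elim: k => [|k [IH1 IH2]]; first by rewrite mul0r rinner_ge0.
have Kz := Kgrow k Ky; rewrite iterS; move: (iter k grow y) Kz IH1 IH2 => z Kz.
have Kdz := Kd Kz; rewrite /grow (linear_onD ld)// !rinnerE.
have := d0 Kz; have := d0 Kdz; have := rinner_ge0 (d (d z)).
rewrite (rinnerC z (d z)) (rinnerC (d z) (d (d z))) -natr1; lra.
Qed.

(* [d c = - c d] for the commutator [c], so [(1 + d)^k c = c (1 - d)^k] stays
   bounded, whereas [k ‖d y‖^2 <= ‖(1 + d)^k y‖^2]. *)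
Let dc0 x : K x -> d (c x) = 0.
Proof.
move=> Kx; apply: rinner_eq0; apply/eqP; rewrite eq_le rinner_ge0 andbT.
rewrite leNgt; apply/negP => dcx0.
have bound k : k%:R * rinner (d (c x)) (d (c x)) <= 4 * rinner x x.
  apply: (le_trans (grow_norm k (Kc Kx)).1); rewrite grow_c//.
  apply: (le_trans (c_norm (Kshrink k Kx))); rewrite ler_pM2l//.
  elim: k => //= k IH; apply: (le_trans (shrink_norm _)) => //; exact: Kshrink.
have := archi_boundP (divr_ge0 (mulr_ge0 (ler0n R 4) (rinner_ge0 x)) (ltW dcx0)).
by rewrite ltr_pdivrMr// ltNge bound.
Qed.

(** The vector [c x] is orthogonal to both terms of the commutator: to [d (b x)] because [d c = 0],
    and to [b (d x)] because [d b c = 0], which follows from [d^2 b c = b d^2 c = 0]. *)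
Lemma defect_comm x : K x -> d (b x) = b (d x).
Proof.
move=> Kx; apply/eqP; rewrite -subr_eq0; apply/eqP/rinner_eq0.
have Kcx := Kc Kx; have Kbcx := Kb Kcx; have Kdx := Kd Kx; have Kbx := Kb Kx.
have dbc0 : d (b (c x)) = 0.
  have db2 : d (d (b (c x))) = 0.
    rewrite dd// -[b (c x) - _](linear_onB sK lb) ?dd -?dd//; last by auto.
    by rewrite dc0// (linear_on0 sK ld) (linear_on0 sK lb).
  by apply: rinner_eq0; rewrite dotd ?db2 ?(rinnerC _ 0) ?rinner0l//; auto.
rewrite -/(c x) {2}/c rinnerDr rinnerNr -dotd// dc0// rinner0l sub0r.
by rewrite -dotb// -dotd ?dbc0 ?rinner0l ?oppr0.
Qed.

End Defect.

Record commuting_defect {R : realType} {U : innerProductType R} (K : set U)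
    (b d : U -> U) : Prop := CommutingDefect {
  defect_subspace : linear_subspace K;
  defect_linear : linear_on K b;
  defect_linear_root : linear_on K d;
  defect_stable : forall x, K x -> K (b x);
  defect_stable_root : forall x, K x -> K (d x);
  defect_hermitian : hermitian_on K b;
  defect_hermitian_root : hermitian_on K d;
  defect_rootE : forall x, K x -> d (d x) = x - b (b x);
  defect_commute : forall x, K x -> d (b x) = b (d x) }.

Lemma commuting_defectN {R : realType} {U : innerProductType R} (K : set U)
    (b d : U -> U) : commuting_defect K b d ->
  commuting_defect K (fun x => - b x) (fun x => - d x).
Proof.
move=> [sK lb ld Kb Kd hb hd dd db]; split=> //.
- by move=> a x y Kx Ky; rewrite lb// opprD scalerN.
- by move=> a x y Kx Ky; rewrite ld// opprD scalerN.
- by move=> x Kx; apply: subspaceN => //; apply: Kb.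
- by move=> x Kx; apply: subspaceN => //; apply: Kd.
- by move=> x y Kx Ky; rewrite linearNl linearNr/= hb.
- by move=> x y Kx Ky; rewrite linearNl linearNr/= hd.
- move=> x Kx; rewrite (linear_onN sK ld) ?(linear_onN sK lb) ?opprK ?dd//; auto.
- move=> x Kx; rewrite (linear_onN sK ld) ?(linear_onN sK lb) ?opprK ?db//; auto.
Qed.

(** The form of [1 + J] at [(x, y)], where [J = [b, d; d, -b]] is the Julia operator of [b]. *)
Definition julia_form {R : realType} {U : innerProductType R} (b d : U -> U)
    x y :=
  inner x x + inner (b x) x + inner (d y) x + inner (d x) y
    + inner y y - inner (b y) y.

Section Julia.
Context {R : realType} {U : innerProductType R} {K : set U} {b d : U -> U}.
Hypothesis bd : commuting_defect K b d.

Let sK := defect_subspace bd.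
Let lb := defect_linear bd.
Let ld := defect_linear_root bd.
Let Kb := defect_stable bd.
Let Kd := defect_stable_root bd.
Let hb := defect_hermitian bd.
Let hd := defect_hermitian_root bd.
Let dd := defect_rootE bd.
Let db := defect_commute bd.

(* The matrix [1 + b, d; d, 1 - b] squares to its double. *)
Lemma julia_formE x y : K x -> K y -> 2 * julia_form b d x y =
  inner (x + b x + d y) (x + b x + d y) + inner (d x + y - b y) (d x + y - b y).
Proof.
move=> Kx Ky.
have Kbx := Kb Kx; have Kdx := Kd Kx; have Kby := Kb Ky; have Kdy := Kd Ky.
have e1 : inner (d x) (d x) = inner x x - inner (b x) (b x).
  by rewrite -[LHS]hd ?dd ?linearBl/= ?hb.
have e2 : inner (d y) (d y) = inner y y - inner (b y) (b y).
  by rewrite -[LHS]hd ?dd ?linearBl/= ?hb.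
have e3 : inner (b x) (d y) = inner (d x) (b y).
  by rewrite -hd// db// hb.
have e4 : inner (d y) (b x) = inner (b y) (d x).
  by rewrite hd// db// -hb.
rewrite /julia_form !linearDl/= !linearNl/= !linearDr/= !linearNr/= e1 e2 e3 e4.
rewrite -(hb Kx Kx) -(hd Kx Ky) -(hd Ky Kx) -(hb Ky Ky).
ring.
Qed.

Lemma julia_form_ge0 x y : K x -> K y -> 0 <= julia_form b d x y.
Proof.
move=> Kx Ky; rewrite -(pmulr_rge0 _ (ltr0n R[i] 2)) julia_formE//.
by rewrite addr_ge0// inner_ge0.
Qed.

(** The matrix [[1 + b, d; d, 1 - b]] annihilates [(- (z - b z), d z)]: the first row by
    [d^2 = 1 - b^2], the second by commutation. The second argument can thus be moved along the
    range of [d] at no cost. *)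
Lemma julia_form_shift x y z : K x -> K y -> K z ->
  julia_form b d (x - (z - b z)) (y + d z) = julia_form b d x y.
Proof.
move=> Kx Ky Kz.
have Kbz := Kb Kz; have Kdz := Kd Kz.
have Ku : K (z - b z) by apply: subspaceB.
have Kxu : K (x - (z - b z)) by apply: subspaceB.
have Kydz : K (y + d z) by apply: subspaceD.
have e1 : x - (z - b z) + b (x - (z - b z)) + d (y + d z) = x + b x + d y.
  rewrite (linear_onB sK lb)// (linear_onB sK lb Kz Kbz) (linear_onD ld)// dd//.
  rewrite [X in X + _]addrACA [LHS]addrACA -opprD [z - b z + _]addrA subrK.
  by rewrite addNr addr0.
have e2 : d (x - (z - b z)) + (y + d z) - b (y + d z) = d x + y - b y.
  rewrite (linear_onB sK ld)// (linear_onB sK ld Kz Kbz) (linear_onD lb)// db//.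
  by rewrite [X in X - _]addrACA (opprD (b y)) [LHS]addrACA opprB subrK subrr addr0.
apply: (mulfI (x := 2)); first by rewrite pnatr_eq0.
by rewrite !julia_formE// e1 e2.
Qed.

Lemma julia_form0l y : K y -> julia_form b d 0 y = inner y y - inner (b y) y.
Proof.
move=> Ky; rewrite /julia_form (linear_on0 sK ld) (linear_on0 sK lb).
by rewrite !linear0r !linear0l/= !add0r.
Qed.

End Julia.

(** * Shorted operators to the second summand, seen as operators on [G] *)

Section Shorted.
Context {R : realType} {H G : hilbertType R}.
Implicit Types (L : set (H * G)) (S Z : H * G -> H * G) (T : G -> G).

Lemma inner_sumE (u v : H * G) : inner u v = inner u.1 v.1 + inner u.2 v.2.
Proof. by []. Qed.

Definition corner T (u : H * G) : H * G := (0, T u.2).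

Lemma inner_corner T u : inner (corner T u) u = inner (T u.2) u.2.
Proof. by rewrite inner_sumE/= linear0l add0r. Qed.

Lemma candidate_corner L S T : (forall h, L (0, h)) ->
  shorted_candidate L second_summand S (corner T) <->
  nonneg_operator setT T /\ forall u, L u -> inner (T u.2) u.2 <= inner (S u) u.
Proof.
move=> LG; split=> [[[[lT _ [M bM]] T0] TS _]|[[[lT _ [M bM]] T0] TS]].
  split; last by move=> u /TS; rewrite inner_corner.
  split; last first.
    by move=> h _; have := T0 _ (LG h); rewrite inner_corner !linear0l.
  split=> //.
    move=> a x y _ _; have := lT a _ _ (LG x) (LG y).
    by move=> /(congr1 snd).
  exists M => h _; have := bM _ (LG h); rewrite !inner_sumE/=.
  by rewrite !linear0l !add0r.
split; last by move=> u _.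
  split; last by move=> u Lu; rewrite inner_corner linear0l; have := T0 u.2 I;
    rewrite linear0l.
  split=> //.
  - move=> a x y _ _; rewrite /corner/= lT//; congr pair.
    by transitivity (a *: 0 + 0 : H); first by rewrite scaler0 addr0.
  - by move=> u _; apply: LG.
  (* [M] is an arbitrary complex number; enlarging [inner u.2 u.2] to [inner u u] needs a
     nonnegative factor. *)
  - exists `|M| => u _; rewrite !inner_sumE/= linear0l add0r.
    have bu := bM u.2 I; apply: (le_trans bu).
    rewrite -[leLHS]ger0_norm ?(le_trans _ bu) ?inner_ge0// normrM.
    by rewrite (ger0_norm (inner_ge0 _)) ler_wpM2l ?lerDr ?inner_ge0.
by move=> u Lu; rewrite inner_corner TS.
Qed.

Lemma candidate_eq_on L S Z Z' : linear_subspace L ->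
  (forall u, L u -> Z u = Z' u) ->
  shorted_candidate L second_summand S Z ->
  shorted_candidate L second_summand S Z'.
Proof.
move=> sL ZZ' [[[lZ KZ [M bM]] Z0] ZS rZ]; split.
- split; last by move=> u Lu; rewrite -ZZ' ?Z0.
  split; last by exists M => u Lu; rewrite -ZZ' ?bM.
    by move=> a x y Lx Ly; rewrite -!ZZ' ?lZ//; apply: sL.2.
  by move=> u Lu; rewrite -ZZ'//; apply: KZ.
- by move=> u Lu; rewrite -ZZ' ?ZS.
- by move=> u Lu; rewrite -ZZ'//; apply: rZ.
Qed.

(** A nonnegative [Z] is hermitian, so having its range in [second_summand] forces it to vanish on
    the vectors of [L] orthogonal to that summand. *)
Lemma candidate_is_corner L S Z : linear_subspace L -> (forall h, L (0, h)) ->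
  shorted_candidate L second_summand S Z ->
  forall u, L u -> Z u = corner (fun h => (Z (0, h)).2) u.
Proof.
move=> sL LG [nZ _ rZ] u Lu; have [[lZ KZ _] _] := nZ.
have hZ := nonneg_hermitian sL nZ.
have Lu2 := LG u.2; have Lu1 := subspaceB sL Lu Lu2.
have Zu1 : Z (u - (0, u.2)) = 0.
  apply: (inner_ext sL (KZ _ Lu1) (subspace0 sL)) => v Lv.
  rewrite hZ// linear0l inner_sumE/= (rZ _ Lv) linear0r add0r.
  by rewrite subrr linear0l.
rewrite -[u in LHS](subrK (0, u.2)) (linear_onD lZ)// Zu1 add0r /corner.
by have := rZ _ Lu2; rewrite /second_summand/=; case: (Z _) => z1 z2 /= ->.
Qed.

(** The shorted operator reduced to its action on [G]. Operators shorted in different spaces [L]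
    become comparable in this form. *)
Definition maximal_corner L S T :=
  [/\ nonneg_operator setT T,
      forall u, L u -> inner (T u.2) u.2 <= inner (S u) u &
      forall T', nonneg_operator setT T' ->
        (forall u, L u -> inner (T' u.2) u.2 <= inner (S u) u) ->
        op_le setT T' T].

Lemma maximal_corner_unique L S T T' : maximal_corner L S T ->
  maximal_corner L S T' -> T = T'.
Proof.
move=> [nT TS Tmax] [nT' T'S T'max]; have [[lT _ _] _] := nT.
have [[lT' _ _] _] := nT'; apply/funext => h.
apply/eqP; rewrite -subr_eq0; apply/eqP.
apply: (@null_form_eq0 _ _ setT (fun x => T x - T' x)) => //.
  by move=> a x y _ _; rewrite lT// lT'// scalerBr opprD addrACA.
move=> x _; rewrite linearBl/=; apply/eqP; rewrite subr_eq0 eq_le.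
by rewrite Tmax// T'max.
Qed.

Lemma is_shorted_corner L S T : (forall h, L (0, h)) ->
  maximal_corner L S T -> linear_subspace L ->
  is_shorted L second_summand S (corner T).
Proof.
move=> LG [nT TS Tmax] sL; split; first exact/candidate_corner.
move=> Z' cZ' u Lu; rewrite (candidate_is_corner sL LG cZ')// !inner_corner.
have [nT' T'S] := (candidate_corner S (fun h => (Z' (0, h)).2) LG).1
  (candidate_eq_on sL (candidate_is_corner sL LG cZ') cZ').
exact: (Tmax _ nT' T'S u.2 I).
Qed.

Lemma is_shorted_maximal L S Z : linear_subspace L -> (forall h, L (0, h)) ->
  is_shorted L second_summand S Z ->
  maximal_corner L S (fun h => (Z (0, h)).2).
Proof.
move=> sL LG [cZ Zmax]; have eZ := candidate_is_corner sL LG cZ.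
have [nT TS] := (candidate_corner S _ LG).1 (candidate_eq_on sL eZ cZ).
split=> // T' nT' T'S h _.
have := Zmax (corner T') ((candidate_corner S T' LG).2 (conj nT' T'S)) _ (LG h).
by rewrite inner_corner eZ// inner_corner.
Qed.

(** The representative chosen by [xget] is determined on [L] only. Its corner is again maximal,
    hence equal to [T], and [(0, h)] lies in [L]. *)
Lemma shortedE L S T h : linear_subspace L -> (forall h, L (0, h)) ->
  maximal_corner L S T -> shorted L second_summand S (0, h) = (0, T h).
Proof.
move=> sL LG mT; have sT := is_shorted_corner LG mT sL.
have sZ : is_shorted L second_summand S (shorted L second_summand S).
  by rewrite /shorted; case: xgetP => // /(_ _ sT).
rewrite (candidate_is_corner sL LG sZ.1)//.
by rewrite (maximal_corner_unique mT (is_shorted_maximal sL LG sZ)).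
Qed.

(* No existence of the shorted operators is needed: when there is no maximal
   corner, both sides are the default value [0]. *)
Lemma shorted_transfer L1 L2 S1 S2 h : linear_subspace L1 -> linear_subspace L2 ->
  (forall h, L1 (0, h)) -> (forall h, L2 (0, h)) ->
  (forall T, nonneg_operator setT T ->
    (forall u, L1 u -> inner (T u.2) u.2 <= inner (S1 u) u) <->
    (forall u, L2 u -> inner (T u.2) u.2 <= inner (S2 u) u)) ->
  shorted L1 second_summand S1 (0, h) = shorted L2 second_summand S2 (0, h).
Proof.
move=> sL1 sL2 LG1 LG2 S12.
have m12 T : maximal_corner L1 S1 T <-> maximal_corner L2 S2 T.
  by split=> -[nT TS Tmax]; split=> //; try exact/S12;
    move=> T' nT' T'S; apply: Tmax => //; apply/S12.
have [[T mT]|nT] := pselect (exists T, maximal_corner L1 S1 T).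
  by rewrite (shortedE _ sL1 LG1 mT) (shortedE _ sL2 LG2 ((m12 T).1 mT)).
rewrite /shorted; case: xgetP => [Z _ sZ|_].
  by case: nT; exists (fun h => (Z (0, h)).2); apply: is_shorted_maximal.
case: xgetP => [Z _ sZ|//].
by case: nT; exists (fun h => (Z (0, h)).2); apply/m12/is_shorted_maximal.
Qed.

End Shorted.

(** * Closures, limits of inequalities and orthogonal projections in a Hilbert space *)

Section HilbertGeometry.
Context {R : realType} {H : hilbertType R}.
Implicit Types (x y z u : H) (K : set H).

Lemma norm_ltE u (e : R) : 0 < e -> (`|u| < e%:C%C) = (rinner u u < e ^+ 2).
Proof.
move=> e0; rewrite -(ltr_pXn2r (n := 2))// ?nnegrE//; last by rewrite ler0c ltW.
by rewrite normr_inner innerxx -rmorphXn/= ltcR.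
Qed.

Lemma gt0_complexE (e : R[i]) : 0 < e -> exists2 r : R, 0 < r & e = r%:C%C.
Proof.
by case: e => a b; rewrite ltcE/= => /andP[/eqP -> a0]; exists a.
Qed.

Lemma closure_rinner (A : set H) x : closure A x <->
  forall e : R, 0 < e -> exists2 a, A a & rinner (x - a) (x - a) < e ^+ 2.
Proof.
split=> [clA e e0|near_A W /nbhs_ballP[_ /gt0_complexE[e e0 ->] sW]].
  have [|a [Aa]] := clA (ball x e%:C%C).
    by apply: nbhsx_ballx; rewrite ltcR.
  by rewrite -ball_normE/= norm_ltE//; exists a.
have [a Aa xa] := near_A e e0; exists a; split=> //; apply: sW.
by rewrite -ball_normE/= norm_ltE.
Qed.

Lemma closed_rinner (A : set H) x : closed A ->
  (forall e : R, 0 < e -> exists2 a, A a & rinner (x - a) (x - a) < e ^+ 2) ->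
  A x.
Proof. by move=> /closure_id {2}-> ?; apply/closure_rinner. Qed.

(** Young's inequality, from [‖t x - y‖^2 >= 0]. With [y] of order [t], the right side stays close
    to [‖x‖^2], and no square root is taken. *)
Lemma rinner_sqrD_le (t : R) x y : 0 < t ->
  rinner (x + y) (x + y) <= (1 + t) * rinner x x + (1 + t^-1) * rinner y y.
Proof.
move=> t0; have := rinner_ge0 (t%:C%C *: x - y).
rewrite !rinnerE (rinnerC y x) => xy.
have : 2 * rinner x y <= t * rinner x x + t^-1 * rinner y y.
  rewrite -(ler_pM2l t0) mulrDr [t * (t^-1 * _)]mulrA divff ?gt_eqF// mul1r; lra.
lra.
Qed.

Lemma rinner_min_eq0 x y :
  (forall s : R,
    rinner x x <= rinner (x - s%:C%C *: y) (x - s%:C%C *: y)) ->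
  rinner y x = 0.
Proof.
(* The optimal step would be [r / ‖y‖^2]; adding 1 to the denominator avoids the case [y = 0] and
   still contradicts minimality. *)
set r := rinner y x; pose c := rinner y y + 1 => /(_ (r / c)).
have c0 : 0 < c by rewrite ltr_wpDl ?rinner_ge0.
have ey : rinner y y = c - 1 by rewrite addrK.
have : r / c * c = r by rewrite divfK ?gt_eqF.
rewrite !rinnerE (rinnerC x y) -/r ey; move: (r / c) => s <- sP.
have s2 : s ^+ 2 * (c + 1) <= 0 by lra.
suff -> : s = 0 by rewrite mul0r.
apply/eqP; rewrite -sqrf_eq0 eq_le sqr_ge0 andbT.
by rewrite -(pmulr_lle0 _ (addr_gt0 c0 ltr01)).
Qed.

(** Limit [t -> 0]: errors of size [t ^+ 2] compensate the factor [t^-1] of Young's inequality. *)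
Lemma le_approx (a b : R) :
  (forall t, 0 < t -> a <= (1 + t) * (b + t ^+ 2) + (1 + t^-1) * t ^+ 2) ->
  a <= b.
Proof.
move=> ab; rewrite leNgt; apply/negP => ba.
(* For [t <= 1] the bound exceeds [b] by at most [t * (b + 4) <= t * c], whereas [t] below is chosen
   with [2 * t * c <= a - b]. *)
pose c := `|b| + 4; have c4 : 4 <= c by rewrite /c lerDr.
have bc : b + 4 <= c by rewrite /c lerD2r ler_norm.
pose t := Num.min 1 ((a - b) / (2 * c)).
have c0 : 0 < 2 * c by lra.
have t0 : 0 < t by rewrite /t lt_min ltr01 divr_gt0// subr_gt0.
have t1 : t <= 1 by rewrite /t ge_min lexx.
have tc : t * (2 * c) <= a - b by rewrite -ler_pdivlMr// /t ge_min lexx orbT.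
have := ab t t0; rewrite [(1 + t^-1) * _]mulrDl (_ : t^-1 * t ^+ 2 = t); last first.
  by rewrite expr2 mulrA mulVf ?gt_eqF// mul1r.
have t2 : t ^+ 2 <= t by rewrite expr2 ler_piMr// ltW.
have t3 : t ^+ 2 * t <= t.
  by apply: le_trans t2; rewrite ler_piMr// ltW// exprn_gt0.
have tb : t * (b + 4) <= t * c by rewrite ler_pM2l.
have : 0 < t * c by rewrite mulr_gt0//; lra.
lra.
Qed.

Lemma closed_subspace_subspace K : closed_subspace K -> linear_subspace K.
Proof. by case. Qed.

Lemma subspace_orthocomp K : linear_subspace (orthocomp K).
Proof.
split=> [x _|a x y Nx Ny z Kz]; first by rewrite linear0r.
by rewrite linearPr/= Nx// Ny// mulr0 addr0.
Qed.

Lemma closed_orthocomp_rinner K x :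
  (forall e : R, 0 < e ->
    exists2 a, orthocomp K a & rinner (x - a) (x - a) < e ^+ 2) ->
  orthocomp K x.
Proof.
move=> near_N z Kz.
have orth (z' : H) (b : R[i]) : z' = b *: z -> rinner z' x = 0.
  move=> z'E; apply/eqP; rewrite -sqrf_eq0 -[_ == 0]negbK; apply/negP => r0.
  pose c := rinner z' z' + 1.
  have c0 : 0 < c by rewrite ltr_wpDl ?rinner_ge0.
  have [] := near_N (`|rinner z' x| / c).
    by rewrite divr_gt0// normr_gt0 -sqrf_eq0.
  move=> a Na; apply/negP; rewrite -leNgt.
  have : rinner z' (x - a) = rinner z' x.
    have z'a : rinner z' a = 0 by rewrite z'E /rinner linearZl_LR/= Na// mulr0.
    by rewrite rinnerDr rinnerNr z'a subr0.
  move: (x - a) => u zu.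
  (* Cauchy-Schwarz in disguise: with [r = rinner z' x], it yields [(c + 1) * r^2 <= c^2 * ‖u‖^2],
     so [u] is not shorter than [|r| / c]. *)
  have := rinner_ge0 ((rinner z' x)%:C%C *: z' - c%:C%C *: u).
  rewrite !rinnerE (rinnerC u) zu expr_div_n real_normK ?num_real//.
  rewrite ler_pdivrMr ?exprn_gt0// => ge0.
  have e : c = rinner z' z' + 1 by [].
  have := sqr_ge0 (rinner z' x); nra.
apply/eqP; rewrite eq_complex/=; apply/andP; split; apply/eqP.
  by apply: (orth z 1); rewrite scale1r.
have := orth _ 'i%C erefl; rewrite /rinner linearZl_LR/=.
by case: (inner z x) => a b/=; lra.
Qed.

Lemma orthogonal_decomposition K x : closed_subspace K ->
  exists y, K y /\ orthocomp K (x - y).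
Proof.
move=> cK; have sK := closed_subspace_subspace cK; have [clK K0 _] := cK.
pose E := [set rinner (x - y) (x - y) | y in K].
have infE : has_inf E.
  split; first by exists (rinner (x - 0) (x - 0)), 0.
  by exists 0 => _ [y _ <-]; apply: rinner_ge0.
pose m := inf E.
have mle y : K y -> m <= rinner (x - y) (x - y).
  by move=> Ky; apply: ge_inf; [exact: infE.2|exists y].
have /choice[y yP] n : exists y, K y /\ rinner (x - y) (x - y) < m + n.+1%:R^-1.
  have n0 : 0 < n.+1%:R^-1 :> R by rewrite invr_gt0.
  by have [_ [y Ky <-] ym] := inf_adherent n0 infE; exists y.
(* Parallelogram law: the midpoint of [y n] and [y k] lies in [K], so its squared distance to [x] is
   at least [m]. *)
have close n k : rinner (y n - y k) (y n - y k) <= 2 / n.+1%:R + 2 / k.+1%:R.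
  have [Kn yn] := yP n; have [Kk yk] := yP k.
  have := mle _ (subspaceZ sK (2^-1)%:C%C (subspaceD sK Kn Kk)).
  move: yn yk; rewrite !rinnerE (rinnerC (y n) x) (rinnerC (y k) x).
  rewrite (rinnerC (y k) (y n)); move: n.+1%:R^-1 k.+1%:R^-1 => p q; lra.
have small (e : R) : 0 < e -> exists N, forall n, (N <= n)%N -> n.+1%:R^-1 < e.
  move=> e0; exists (Num.bound e^-1) => n Nn.
  rewrite invf_plt ?posrE//; apply: (lt_le_trans (archi_boundP _)).
    by rewrite invr_ge0 ltW.
  by rewrite ler_nat ltnW.
have /cauchy_cvg/cvg_ex[l yl] : cauchy (y @ \oo).
  apply: cauchy_exP => _ /gt0_complexE[e e0 ->].
  have [N NP] := small (e ^+ 2 / 4) (divr_gt0 (exprn_gt0 2 e0) (ltr0n _ 4)).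
  exists (y N); exists N => // n /= Nn; rewrite -ball_normE/= norm_ltE//.
  have := NP _ (leqnn N); have := NP _ Nn; have := close N n.
  move: N.+1%:R^-1 n.+1%:R^-1 => p q; lra.
have near_l (e : R) : 0 < e -> exists n, rinner (l - y n) (l - y n) < e ^+ 2 /\
    rinner (x - y n) (x - y n) <= m + e ^+ 2.
  move=> e0; have [N NP] := small (e ^+ 2) (exprn_gt0 2 e0).
  have /cvgrPdist_lt/(_ e%:C%C) := yl; rewrite ltcR => /(_ e0)[N' _ N'P].
  exists (maxn N N'); split; first by rewrite -norm_ltE//; apply/N'P/leq_maxr.
  have := NP _ (leq_maxl N N'); have := (yP (maxn N N')).2.
  move: (_.+1%:R^-1) => p; lra.
have Kl : K l.
  apply: closed_rinner => // e /near_l[n [ln _]].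
  by exists (y n) => //; case: (yP n).
have lm : rinner (x - l) (x - l) <= m.
  apply: le_approx => t t0; have [n [ln xn]] := near_l _ t0.
  have := rinner_sqrD_le (x - y n) (y n - l) t0; rewrite addrA subrK => h.
  apply: (le_trans h); rewrite -(opprB l) rinnerNl rinnerNr opprK.
  have t1 : 0 <= 1 + t by rewrite addr_ge0// ltW.
  have t2 : 0 <= 1 + t^-1 by rewrite addr_ge0// invr_ge0 ltW.
  by apply: lerD; rewrite ler_wpM2l// ltW.
exists l; split=> // z Kz.
have orth z' : K z' -> rinner z' (x - l) = 0.
  move=> Kz'; apply: rinner_min_eq0 => s; rewrite -addrA -opprD.
  by apply: (le_trans lm); apply/mle/subspaceD/subspaceZ.
apply/eqP; rewrite eq_complex/=; apply/andP; split; apply/eqP.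
  exact: (orth z).
have := orth _ (subspaceZ sK 'i%C Kz); rewrite /rinner linearZl_LR/=.
by case: (inner z _) => a b/=; lra.
Qed.

Lemma orthoprojE K x y : linear_subspace K -> K y -> orthocomp K (x - y) ->
  orthoproj K x = y.
Proof.
move=> sK Ky Nxy; rewrite /orthoproj; case: xgetP => [z _ [Kz Nxz]|/(_ y)[]//].
have Kzy := subspaceB sK Kz Ky; apply/eqP; rewrite -subr_eq0; apply/eqP.
apply: rinner_eq0; rewrite /rinner.
have e : z - y = (x - y) - (x - z) by rewrite opprB [RHS]addrC addrA subrK.
by rewrite {2}e linearBr/= Nxy// Nxz// subrr.
Qed.

Lemma orthoprojP K x : closed_subspace K ->
  K (orthoproj K x) /\ orthocomp K (x - orthoproj K x).
Proof.
move=> cK; have [y [Ky Nxy]] := orthogonal_decomposition x cK.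
by rewrite (orthoprojE (closed_subspace_subspace cK) Ky Nxy).
Qed.

Lemma orthoprojD K f n : linear_subspace K -> K f -> orthocomp K n ->
  orthoproj K (f + n) = f.
Proof. by move=> sK Kf Nn; apply: orthoprojE => //; rewrite addrC addKr. Qed.

Lemma orthoproj_orthocompD K f n : K f -> orthocomp K n ->
  orthoproj (orthocomp K) (f + n) = n.
Proof.
move=> Kf Nn; apply: orthoprojE => //; first exact: subspace_orthocomp.
by move=> x Nx; rewrite addrK innerC Nx// conjC0.
Qed.

End HilbertGeometry.

(** * Defect spaces as closures of ranges *)

Section DefectSpaces.
Context {R : realType} {H : hilbertType R}.
Implicit Types (K : set H) (b d : H -> H).

Lemma closed_orthocomp K : closed (orthocomp K).
Proof.
by move=> x /closure_rinner xN; apply: closed_orthocomp_rinner.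
Qed.

Lemma defect_space_sub K d : closed K -> (forall x, K x -> K (d x)) ->
  defect_space K d `<=` K.
Proof.
move=> clK Kd x /closure_rinner xd; apply: closed_rinner => // e /xd[_ [y Ky <-]].
by exists (d y) => //; apply: Kd.
Qed.

Lemma subspace_defect_space K d : linear_subspace K -> linear_on K d ->
  linear_subspace (defect_space K d).
Proof.
move=> sK ld; split.
  apply: subset_closure; exists 0; first exact: (subspace0 sK).
  exact: (linear_on0 sK ld).
move=> a x y /closure_rinner xd /closure_rinner yd; apply/closure_rinner => e e0.
pose c := complex.Re (a * Num.conj a) + 1.
have a0 : 0 <= a * Num.conj a by exact: mul_conjC_ge0.
have aa : a * Num.conj a = (c - 1)%:C%C.
  by rewrite /c addrK RRe_real// ger0_real.
have c1 : 1 <= c by rewrite lerDr -ler0c RRe_real// ger0_real.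
have c0 : 0 < c by apply: lt_le_trans c1.
(* Young's inequality with weight 1 bounds the squared error by
   [2 * (|a|^2 + 1) * r^2 = 2 * c * r^2], which is less than [e^2 = 4 * c^2 * r^2] since
   [c >= 1]. *)
pose r := e / (2 * c); have r0 : 0 < r by rewrite divr_gt0// mulr_gt0.
have [_ [x' Kx' <-] xx'] := xd r r0; have [_ [y' Ky' <-] yy'] := yd r r0.
exists (a *: d x' + d y').
  by exists (a *: x' + y'); [apply: sK.2|rewrite ld].
have -> : a *: x + y - (a *: d x' + d y') = a *: (x - d x') + (y - d y').
  by rewrite scalerBr opprD addrACA.
move: (x - d x') (y - d y') xx' yy' => u v ur vr.
apply: (le_lt_trans (rinner_sqrD_le _ _ ltr01)); rewrite invr1.
have -> : rinner (a *: u) (a *: u) = (c - 1) * rinner u u.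
  rewrite /rinner linearZl_LR/= linearZr_LR/= mulrA aa.
  by case: (inner u u) => p q /=; rewrite mul0r subr0.
have -> : e = 2 * (r * c) by rewrite /r; field; rewrite gt_eqF.
have : (c - 1) * rinner u u <= (c - 1) * r ^+ 2.
  by rewrite ler_wpM2l ?subr_ge0// ltW.
have : r ^+ 2 * c <= r ^+ 2 * c ^+ 2.
  by rewrite ler_pM2l ?exprn_gt0// expr2 ler_pMr.
have : 0 < r ^+ 2 * c by rewrite mulr_gt0 ?exprn_gt0.
lra.
Qed.

Lemma defect_spaceN K d : linear_subspace K -> linear_on K d ->
  defect_space K (fun x => - d x) = defect_space K d.
Proof.
move=> sK ld; congr closure; apply/seteqP; split=> _ [x Kx <-]; exists (- x).
- exact: (subspaceN sK Kx).
- exact: (linear_onN sK ld Kx).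
- exact: (subspaceN sK Kx).
- by rewrite (linear_onN sK ld Kx) opprK.
Qed.

(** Commutation makes [b] preserve the range of [d], and contractivity carries this over to the
    closure. *)
Lemma defect_space_stable K b d : commuting_defect K b d -> closed K ->
  forall x, defect_space K d x -> defect_space K d (b x).
Proof.
move=> bd clK x xd; have sK := defect_subspace bd.
have Kd := defect_stable_root bd; have Kb := defect_stable bd.
have Kx := defect_space_sub clK Kd xd; move: xd => /closure_rinner xd.
apply/closure_rinner => e /xd[_ [y Ky <-] xy]; exists (b (d y)).
  by rewrite -(defect_commute bd)//; exists (b y) => //; apply: Kb.
have Kdy := Kd _ Ky; rewrite -(linear_onB sK (defect_linear bd))//.
apply: le_lt_trans xy.
have Kz := subspaceB sK Kx Kdy.
have := defect_norm Kb Kd (defect_hermitian bd) (defect_hermitian_root bd)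
  (defect_rootE bd) Kz.
have := rinner_ge0 (d (x - d y)); lra.
Qed.

End DefectSpaces.

(** * Nonnegative forms and the operators [I ± X] *)

Section Forms.
Context {R : realType} {U : innerProductType R}.
Implicit Types (K : set U) (S X : U -> U).

Record nonneg_form K S : Prop := NonnegForm {
  form_linear : linear_on K S;
  form_hermitian : hermitian_on K S;
  form_ge0 : forall x, K x -> 0 <= rinner (S x) x }.

(** Young's inequality for the semi-inner product of [S]: expand the form at [t x - y]. *)
Lemma nonneg_form_approx K S (t : R) x y : linear_subspace K -> nonneg_form K S ->
  0 < t -> K x -> K y ->
  rinner (S (x + y)) (x + y)
    <= (1 + t) * rinner (S x) x + (1 + t^-1) * rinner (S y) y.
Proof.
move=> sK [lS hS S0] t0 Kx Ky; have Ktx := subspaceZ sK t%:C%C Kx.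
have := S0 _ (subspaceB sK Ktx Ky).
rewrite (linear_onB sK lS)// (linear_onD lS)// (linear_onZ sK lS)// !rinnerE.
rewrite (hermitian_rinner hS Ky Kx) (rinnerC y (S x)) => xy.
have : 2 * rinner (S x) y <= t * rinner (S x) x + t^-1 * rinner (S y) y.
  rewrite -(ler_pM2l t0) mulrDr [t * (t^-1 * _)]mulrA divff ?gt_eqF// mul1r; lra.
lra.
Qed.

(** Both bounds express [|(X x, x)| <= ‖x‖^2]. The upper one serves as continuity of the form when
    vectors are approximated. *)
Lemma contraction_form K X : linear_subspace K -> selfadjoint_contraction K X ->
  nonneg_form K (idfun \+ X) /\
  forall x, K x -> rinner ((idfun \+ X) x) x <= 2 * rinner x x.
Proof.
move=> sK [[[lX KX _] bX] hX].
have bX' x : K x -> rinner (X x) (X x) <= rinner x x.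
  by move=> /bX; rewrite lecE => /andP[].
split=> [|x Kx]; last first.
  rewrite /= rinnerDl; have := rinner_sqrB (X x) x; have := bX' _ Kx; lra.
split.
- by move=> a x y Kx Ky; rewrite /= lX// scalerDr addrACA.
- by move=> x y Kx Ky; rewrite /= linearDl linearDr/= hX.
move=> x Kx; have := rinner_sqrB (- X x) x; have := bX' _ Kx.
rewrite /= !rinnerE; lra.
Qed.

Lemma selfadjoint_contractionN K X : linear_subspace K ->
  selfadjoint_contraction K X -> selfadjoint_contraction K (fun x => - X x).
Proof.
move=> sK [[[lX KX [M bM]] bX] hX].
have XN x : inner (- X x) (- X x) = inner (X x) (X x).
  by rewrite linearNl linearNr/= opprK.
split; last by move=> x y Kx Ky; rewrite linearNl linearNr/= hX.
split; last by move=> x Kx; rewrite XN bX.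
split.
- by move=> a x y Kx Ky; rewrite lX// opprD scalerN.
- by move=> x Kx; apply: subspaceN => //; apply: KX.
- by exists M => x Kx; rewrite XN bM.
Qed.

End Forms.

(** * Comparison of the minorants of the two forms *)

Section FormTransfer.
Context {R : realType} {H G : hilbertType R}.
Variables (H0 : set H) (b d K0s Dk : H -> H) (S1 S2 : H * G -> H * G).
Let N := orthocomp H0.
Let L : set (H * G) := defect_space N Dk `*` setT.
Hypotheses (cH0 : closed_subspace H0) (bd : commuting_defect H0 b d).
Hypothesis sL : linear_subspace L.
Hypothesis K0sP : forall n, N n -> defect_space H0 d (K0s n).
Hypothesis nS2 : nonneg_form L S2.
Hypothesis bS2 : forall u, L u -> rinner (S2 u) u <= 2 * rinner u u.
Hypothesis S1E : forall f n h, H0 f -> N n ->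
  inner (S1 (f + n, h)) (f + n, h) =
  julia_form b d f (K0s n) + inner (S2 (Dk n, h)) (Dk n, h).

Let L_Dk n h : N n -> L (Dk n, h).
Proof. by move=> Nn; split=> //; apply: subset_closure; exists n. Qed.

Let H0_K0s n : N n -> H0 (K0s n).
Proof.
move=> /K0sP; apply: defect_space_sub; first by case: cH0.
exact: defect_stable_root bd.
Qed.

Let S2_ge0 u : L u -> 0 <= inner (S2 u) u.
Proof.
move=> Lu; have := form_ge0 nS2 Lu; have := innerC (S2 u) u.
rewrite -(form_hermitian nS2 Lu Lu) /rinner; case: (inner _ _) => p q [q0].
by rewrite lecE/= => ->; rewrite andbT; apply/eqP; lra.
Qed.

(* The first component of [(f + n, h)] is at our disposal, and
   [julia_form b d f (K0s n)] has infimum [0] over [f] because [K0s n] is close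
   to the range of [d]. *)
Let form_below (t : R) k h : 0 < t -> L (k, h) -> exists z,
  rinner (S1 (z, h)) (z, h) <=
  (1 + t) * (rinner (S2 (k, h)) (k, h) + t ^+ 2) + (1 + t^-1) * t ^+ 2.
Proof.
move=> t0 Lkh; have [/closure_rinner kD _] := Lkh.
have sH := defect_subspace bd.
(* Both errors are at most twice a squared distance, by [bS2] and by [(r - b r, r) <= 2 ‖r‖^2]; the
   radius [t / 2] keeps each of them below [t ^+ 2]. *)
have r0 : 0 < t / 2 by rewrite divr_gt0.
have [_ [n Nn <-] kn] := kD _ r0.
have [_ [g Hg <-] mg] := (closure_rinner _ _).1 (K0sP Nn) _ r0.
have Hdg := defect_stable_root bd Hg.
have Hr := subspaceB sH (H0_K0s Nn) Hdg.
have [r rE] : exists r, r = K0s n - d g by exists (K0s n - d g).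
have mE : K0s n = r + d g by rewrite rE subrK.
rewrite -rE in mg Hr.
have Hf : H0 (0 - (g - b g)).
  apply: subspaceB => //; first exact: (subspace0 sH).
  by apply: subspaceB => //; apply: (defect_stable bd).
(* Since [K0s n = r + d g], [julia_form_shift] reduces this choice of [f] to the pair [(0, r)],
   where only the small residue [r] contributes. *)
exists (0 - (g - b g) + n).
have S1v : rinner (S1 (0 - (g - b g) + n, h)) (0 - (g - b g) + n, h) =
    rinner r r - rinner (b r) r + rinner (S2 (Dk n, h)) (Dk n, h).
  rewrite {1}/rinner S1E// mE (julia_form_shift bd) ?(julia_form0l bd)//.
    rewrite /rinner.
    by case: (inner r r) (inner (b r) r) (inner (S2 _) _) => ? ? [? ?] [? ?].
  exact: (subspace0 sH).
have Lv : L (Dk n - k, 0).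
  have := subspaceB sL (L_Dk h Nn) Lkh.
  by rewrite [X in L X](_ : _ = (Dk n - k, h - h))// subrr.
have := nonneg_form_approx sL nS2 t0 Lkh Lv.
have -> : (k, h) + (Dk n - k, 0) = (Dk n, h) :> H * G.
  by transitivity (k + (Dk n - k), h + 0); rewrite // addr0 addrC subrK.
have vv : rinner ((Dk n - k, 0) : H * G) (Dk n - k, 0) < (t / 2) ^+ 2.
  rewrite /rinner inner_sumE/= linear0r addr0 -/(rinner _ _).
  by rewrite -(opprB k) rinnerNl rinnerNr opprK.
have := bS2 Lv; move: vv.
move: (rinner (S2 (Dk n - k, 0)) _) (rinner (Dk n - k, 0) _) => q v vt qv.
have t2 := sqr_ge0 t; have q2 : q <= t ^+ 2 by lra.
have : (1 + t^-1) * q <= (1 + t^-1) * t ^+ 2.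
  by rewrite ler_wpM2l// addr_ge0// invr_ge0 ltW.
have rr : rinner r r - rinner (b r) r <= t ^+ 2.
  have := rinner_sqrB (- b r) r.
  have := defect_norm (defect_stable bd) (defect_stable_root bd)
    (defect_hermitian bd) (defect_hermitian_root bd) (defect_rootE bd) Hr.
  have := rinner_ge0 (d r); rewrite !rinnerE; lra.
have := mulr_gt0 t0 (exprn_gt0 2 t0).
rewrite S1v; move: (t^-1) => t'; lra.
Qed.

(** The form of [T] ignores the first component, so a minorant of [S1] may be tested at the best
    vector [z] of [form_below]; conversely, the form of [S1] exceeds that of [S2] by a nonnegative
    [julia_form]. *)
Lemma form_transfer (T : G -> G) : nonneg_operator setT T ->
  (forall u, setT u -> inner (T u.2) u.2 <= inner (S1 u) u) <->
  (forall u, L u -> inner (T u.2) u.2 <= inner (S2 u) u).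
Proof.
move=> nT; split=> TS.
  move=> [k h] Lkh /=.
  have Tr : inner (T h) h = (rinner (T h) h)%:C%C.
    by rewrite RRe_real// ger0_real//; have := nT.2 h I; rewrite linear0l.
  have S2r : inner (S2 (k, h)) (k, h) = (rinner (S2 (k, h)) (k, h))%:C%C.
    by rewrite RRe_real// ger0_real// S2_ge0.
  rewrite Tr S2r lecR; apply: le_approx => t t0.
  have [z zP] := form_below t0 Lkh; apply: le_trans zP.
  by have := TS (z, h) I; rewrite lecE => /andP[].
move=> [x h] _ /=; have [Hf Nn] := orthoprojP x cH0.
rewrite -(subrK (orthoproj H0 x) x) [_ - _ + _]addrC S1E//.
apply: (le_trans (TS _ (L_Dk h Nn))); rewrite lerDr.
by apply: (julia_form_ge0 bd) => //; apply: H0_K0s.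
Qed.

End FormTransfer.

(** * The compression [B0] and its defect operator *)

Section Compression.
Context {R : realType} {H : hilbertType R}.
Variables (H0 : set H) (B : H -> H).
Hypothesis cH0 : closed_subspace H0.

Lemma compression_sub x : H0 (compression H0 B x).
Proof. by have [] := orthoprojP (B x) cH0. Qed.

Lemma compression_hermitian : hermitian_on H0 B ->
  hermitian_on H0 (compression H0 B).
Proof.
move=> hB x y Hx Hy; rewrite /compression/=.
have [_ NBx] := orthoprojP (B x) cH0; have [_ NBy] := orthoprojP (B y) cH0.
have e1 : inner (B x) y - inner (orthoproj H0 (B x)) y = 0.
  by rewrite -linearBl/= innerC NBx// conjC0.
have e2 : inner x (B y) - inner x (orthoproj H0 (B y)) = 0.
  by rewrite -linearBr/= NBy.
by rewrite -(subr0_eq e1) -(subr0_eq e2) hB.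
Qed.

(** The adjoint supplied by [is_defect] agrees on [H0] with the hermitian [B0]; linearity of [B0] is
    read off from this adjoint. *)
Lemma compression_defect D : hermitian_on H0 B ->
  is_defect H0 H0 (compression H0 B) D ->
  commuting_defect H0 (compression H0 B) D.
Proof.
move=> hB [A [[lA HA _] BA] [nD DD]]; have hB0 := compression_hermitian hB.
have sH := closed_subspace_subspace cH0.
have B0A x : H0 x -> compression H0 B x = A x.
  move=> Hx; have HB0x := compression_sub x; have HAx := HA _ Hx.
  apply: (inner_ext sH) => // z Hz.
  by rewrite innerC -(hB0 _ _ Hz Hx) BA// -innerC.
have lB0 : linear_on H0 (compression H0 B).
  by move=> a x y Hx Hy; rewrite !B0A ?lA//; apply: sH.2.
have [[lD HD _] _] := nD; have hD := nonneg_hermitian sH nD.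
have HB0 x : H0 x -> H0 (compression H0 B x) by move=> _; apply: compression_sub.
have D2 x : H0 x -> D (D x) = x - compression H0 B (compression H0 B x).
  by move=> Hx; rewrite DD// -B0A//; apply: compression_sub.
split=> // x Hx; apply: (defect_comm sH lB0 lD HB0 HD hB0 hD D2) => // y.
exact: nonneg_rinner.
Qed.

End Compression.

(** * The quadratic form of the block extension *)

Section TildeB.
Context {R : realType} {H G : hilbertType R}.
Variables (H0 : set H) (B0 D K0 K0s Dk : H -> H)
  (X11 : H -> H) (X12 : G -> H) (X21 : H -> G) (X22 : G -> G).
Let N := orthocomp H0.
Let DB0 := defect_space H0 D.
Let DK := defect_space N Dk.
Hypotheses (cH0 : closed_subspace H0) (bD : commuting_defect H0 B0 D).
Hypotheses (adjK0 : is_adjoint DB0 N K0 K0s) (defK0s : is_defect N DB0 K0s Dk).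
Hypotheses (KN : forall x, DB0 x -> N (K0 x)).
Hypotheses (X11P : forall k, DK k -> DK (X11 k)) (X12P : forall h, DK (X12 h)).

Let sN : linear_subspace N := subspace_orthocomp H0.

Lemma defect_hermitian_adjoint : hermitian_on N Dk.
Proof. by have [A _ [nDk _]] := defK0s; apply: nonneg_hermitian. Qed.

Lemma defect_adjoint_linear : linear_on N Dk.
Proof. by have [A _ [[[lDk _ _] _] _]] := defK0s. Qed.

Lemma defect_adjoint_sub n : N n -> N (Dk n).
Proof. by have [A _ [[[_ NDk _] _] _]] := defK0s; apply: NDk. Qed.

(** This is [Dk^2 = 1 - A K0s] with [A] the adjoint of [K0s]. It divides the identity on [N] between
    [julia_form] and the form of [I ± X]. *)
Lemma defect_adjoint_norm n : N n ->
  inner n n = inner (K0s n) (K0s n) + inner (Dk n) (Dk n).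
Proof.
move=> Nn; have [A [[_ AN _] adjA] [nDk DD]] := defK0s.
have [[_ K0sP _] _] := adjK0.
have NDk := defect_adjoint_sub Nn.
rewrite -(defect_hermitian_adjoint NDk Nn) DD// linearBl/=.
have -> : inner (A (K0s n)) n = inner (K0s n) (K0s n).
  by rewrite innerC -(adjA _ _ Nn (K0sP _ Nn)) -innerC.
by rewrite addrC subrK.
Qed.

Lemma tildeB_form f n h : H0 f -> N n ->
  inner (tildeB H0 B0 D K0 K0s Dk X11 X12 X21 X22 (f + n, h)) (f + n, h) =
  inner (B0 f) f + inner (D (K0s n)) f + inner (D f) (K0s n)
    - inner (B0 (K0s n)) (K0s n)
    + inner (block_op X11 X12 X21 X22 (Dk n, h)) (Dk n, h).
Proof.
move=> Hf Nn; have sH := defect_subspace bD.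
have [[_ K0sP _] adj] := adjK0.
have Dm := K0sP _ Nn.
have clH : closed H0 by case: cH0.
have Hm := defect_space_sub clH (defect_stable_root bD) Dm.
(* The adjoint relation between [K0] and [K0s] is available on [DB0] only, and [K0] is applied to
   [B0 (K0s n)]. *)
have DBm : DB0 (B0 (K0s n)) by apply: (defect_space_stable bD).
have DDf : DB0 (D f) by apply: subset_closure; exists f.
have HN x y : H0 x -> N y -> inner x y = 0 by move=> Hx; apply.
have NH x y : N x -> H0 y -> inner x y = 0.
  by move=> Nx Hy; rewrite innerC HN// conjC0.
have DKN k : DK k -> N k.
  by apply: defect_space_sub; [exact: closed_orthocomp|exact: defect_adjoint_sub].
have DKk : DK (Dk n) by apply: subset_closure; exists n.
have HB0f := defect_stable bD Hf; have HDm := defect_stable_root bD Hm.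
have NK0f := KN DDf; have NK0m := KN DBm.
have NX11 := DKN _ (X11P DKk); have NX12 := DKN _ (@X12P h).
have NDX11 := defect_adjoint_sub NX11; have NDX12 := defect_adjoint_sub NX12.
have hDk := defect_hermitian_adjoint.
rewrite /tildeB/= (orthoprojD sH Hf Nn) (orthoproj_orthocompD Hf Nn).
rewrite !inner_sumE/= !linearDl/= !linearNl/= !linearDr/=.
rewrite (HN _ _ HB0f Nn) (HN _ _ HDm Nn) (NH _ _ NK0f Hf) (NH _ _ NK0m Hf).
rewrite (NH _ _ NDX11 Hf) (NH _ _ NDX12 Hf) !adj// !hDk//.
ring.
Qed.

End TildeB.

(** Abstract operators [b], [d], [C], [Y] let both signs be instances of one statement. *)
Lemma shorted_block {R : realType} {H G : hilbertType R} (H0 : set H)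
    (b d K0s Dk : H -> H) (C Y : H * G -> H * G)
    (L := defect_space (orthocomp H0) Dk `*` [set: G]) h :
  closed_subspace H0 -> commuting_defect H0 b d -> linear_subspace L ->
  (forall n, orthocomp H0 n -> defect_space H0 d (K0s n)) ->
  (forall n, orthocomp H0 n ->
    inner n n = inner (K0s n) (K0s n) + inner (Dk n) (Dk n)) ->
  selfadjoint_contraction L Y ->
  (forall f n h, H0 f -> orthocomp H0 n ->
    inner (C (f + n, h)) (f + n, h) =
    inner (b f) f + inner (d (K0s n)) f + inner (d f) (K0s n)
      - inner (b (K0s n)) (K0s n) + inner (Y (Dk n, h)) (Dk n, h)) ->
  shorted setT second_summand (idfun \+ C) (0, h) =
  shorted L second_summand (idfun \+ Y) (0, h).
Proof.
move=> cH0 bd sL K0sP nn cY CE; have [nY bY] := contraction_form sL cY.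
apply: shorted_transfer => // [h'|T].
  by split=> //; have [] := subspace0 sL.
apply: (form_transfer cH0 bd sL K0sP nY bY) => f n h' Hf Nn.
rewrite /= [LHS]linearDl/= CE// [inner (_ + _) (Dk n, h')]linearDl/=.
(* The identity contributes [‖f‖^2 + ‖K0s n‖^2] to [julia_form] and [‖Dk n‖^2 + ‖h'‖^2] to the form
   of [I + Y]. *)
rewrite !inner_sumE/= /julia_form !linearDl/= !linearDr/= (nn n Nn).
have fn : inner f n = 0 by apply: Nn.
rewrite (innerC n) fn conjC0; ring.
Qed.

Theorem theorem3p3 (R : realType) (H G : hilbertType R)
    (H0 : set H) (B : H -> H) (D K0 K0s Dk : H -> H)
    (X11 : H -> H) (X12 : G -> H) (X21 : H -> G) (X22 : G -> G)
    (N := orthocomp H0) (B0 := compression H0 B)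
    (DB0 := defect_space H0 D) (DK := defect_space N Dk)
    (X := block_op X11 X12 X21 X22)
    (BX := tildeB H0 B0 D K0 K0s Dk X11 X12 X21 X22) :
  nondense_hermitian_contraction H0 B ->
  is_defect H0 H0 B0 D ->
  contractive_op DB0 N K0 ->
  (forall f, H0 f -> K0 (D f) = orthoproj N (B f)) ->
  is_adjoint DB0 N K0 K0s ->
  is_defect N DB0 K0s Dk ->
  operator DK DK X11 ->
  operator setT DK X12 ->
  is_adjoint setT DK X12 X21 ->
  operator setT setT X22 ->
  selfadjoint_contraction (DK `*` setT) X ->
  forall h : G,
    shorted setT second_summand (idfun \+ BX) (0, h) =
      shorted (DK `*` setT) second_summand (idfun \+ X) (0, h) /\
    shorted setT second_summand (idfun \- BX) (0, h) =
      shorted (DK `*` setT) second_summand (idfun \- X) (0, h).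
Proof.
move=> [cH0 _ _ hB] defD [[_ KN _] _] _ adjK0 defK0s [_ X11P _] [_ X12P _] _ _ cX h.
have bD := compression_defect cH0 hB defD.
have [[_ K0sP _] _] := adjK0.
have norm_N := defect_adjoint_norm adjK0 defK0s.
have BXE := tildeB_form X21 X22 cH0 bD adjK0 defK0s KN X11P (fun h => X12P h I).
have sDK : linear_subspace DK.
  apply: subspace_defect_space; first exact: subspace_orthocomp.
  exact: (defect_adjoint_linear defK0s).
have sL : linear_subspace (DK `*` [set: G]).
  split; first by split=> //; apply: (subspace0 sDK).
  by move=> a x y [Lx _] [Ly _]; split=> //; apply: sDK.2.
split; first exact: (shorted_block _ cH0 bD sL K0sP norm_N cX BXE).
(* Each term of [tildeB_form] is linear in exactly one of [B0], [D], [X]; changing these three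
   signs, with [K0s] and [Dk] fixed, changes the sign of the whole form. *)
have := shorted_block h cH0 (commuting_defectN bD) sL _ norm_N
  (selfadjoint_contractionN sL cX).
apply=> [n Nn|f n h' Hf Nn].
  rewrite (defect_spaceN (defect_subspace bD) (defect_linear_root bD)).
  exact: K0sP.
rewrite !linearNl/= BXE//.
rewrite -[sum_inner _ _]/(inner (X (Dk n, h')) (Dk n, h')) /X; ring.
Qed.
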